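(* Let $p$ be a prime and $a,b$ integers. Let $\mathbf{C}=\begin{bmatrix}1&a\\ b&1+ab\end{bmatrix}$ and, for $k\ge1$, consider the Cat map $(x,y)^\intercal\mapsto\mathbf{C}(x,y)^\intercal\bmod p^k$ on $\mathbb{Z}_{p^k}^2$. Let $N_{T,k}$ denote the number of cycles of length $T$ in its functional graph on $\mathbb{Z}_{p^k}^2$. Then for every positive integer $T_{\rm c}$ with $\nu(T_{\rm c})>p$ and every $k\ge1$, \[ p\cdot N_{T_{\rm c},k}=N_{p\cdot T_{\rm c},k+1}. \]
   Context: $\mathbb{Z}_{p^k}$ is the ring of integers modulo $p^k$; $\nu(x)$ is the exponent of the highest power of $p$ dividing the integer $x$. The Cat map is a permutation of $\mathbb{Z}_{p^k}^2$ since $\det\mathbf{C}=1$, so its functional graph is a disjoint union of cycles. *)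

(* Defs.v *)
From mathcomp Require Import all_boot all_order all_algebra.

Set Implicit Arguments.
Unset Strict Implicit.
Unset Printing Implicit Defensive.

Import GRing.Theory.
Local Open Scope ring_scope.

Definition cat_matrix (a b : int) : 'M[int]_2 :=
  \matrix_(i < 2, j < 2) (nth [::] [:: [:: 1; a]; [:: b; 1 + a * b]] i)`_j.

(* 'Z_n denotes the integers modulo n only when 1 < n; here n = p ^ k with
   p prime and 0 < k. *)
Definition cat_map (p : nat) (a b : int) (k : nat)
    (v : 'cV['Z_(p ^ k)]_2) : 'cV['Z_(p ^ k)]_2 :=
  map_mx intr (cat_matrix a b) *m v.

(* fcard f A counts the f-orbits contained in the f-invariant set A, and
   order_set f T is the set of points whose f-orbit has T elements.  The Cat map
   is bijective, so these orbits are exactly the cycles of its functional graph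
   and the size of an orbit is the length of the cycle. *)
Definition num_cycles (p : nat) (a b : int) (T k : nat) : nat :=
  fcard (@cat_map p a b k) (order_set (@cat_map p a b k) T).

(* Main.v *)
(* Call an integer vector v fixed by C^n modulo q when q divides (C^n - 1) v.
   If v is not divisible by p and C^m fixes v modulo p for some m divisible by
   p^3, then C^(m/p^3) has determinant 1 and is unipotent modulo p, so its p-th
   power is 1 modulo p and E := C^(m/p) is 1 modulo p^2.  For such an E,
   (E^p - 1) v has p-adic valuation exactly one more than (E - 1) v.  Hence, when
   p^2 divides n and p^k does not divide v, C^n fixes v modulo p^k if and only if
   C^(pn) fixes v modulo p^(k+1).  Applied to n = T and to n = T/q for the primes
   q dividing T, this shows that v has period T modulo p^k if and only if it has
   period pT modulo p^(k+1), as soon as p^3 divides T (when p^k divides v both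
   sides are false).  Each point modulo p^k has p^2 lifts modulo p^(k+1), so there
   are p^2 times as many points on cycles of length pT, hence p times as many
   cycles. *)
Require Import Defs.
From mathcomp Require Import all_boot all_order all_algebra.
From mathcomp Require Import ring.

Set Implicit Arguments.
Unset Strict Implicit.
Unset Printing Implicit Defensive.

Import GRing.Theory.
Local Open Scope ring_scope.

(** * Divisibility of integer matrices and reduction modulo q *)

Definition dvdmx (d : int) m n (A : 'M[int]_(m, n)) : Prop :=
  exists B, A = d *: B.

Lemma dvdmx0 d m n : dvdmx d (0 : 'M_(m, n)).
Proof. by exists 0; rewrite scaler0. Qed.

Lemma dvdmxD d m n (A B : 'M_(m, n)) :
  dvdmx d A -> dvdmx d B -> dvdmx d (A + B).
Proof. by move=> [A' ->] [B' ->]; exists (A' + B'); rewrite scalerDr. Qed.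

Lemma dvdmxN d m n (A : 'M_(m, n)) : dvdmx d A -> dvdmx d (- A).
Proof. by move=> [B ->]; exists (- B); rewrite scalerN. Qed.

Lemma dvdmx_scale d c m n (A : 'M_(m, n)) : dvdmx d A -> dvdmx (c * d) (c *: A).
Proof. by move=> [B ->]; exists B; rewrite scalerA. Qed.

Lemma dvdmx_scalel c m n (A : 'M_(m, n)) : dvdmx c (c *: A).
Proof. by exists A. Qed.

Lemma dvdmx_cancel d c m n (A : 'M_(m, n)) :
  c != 0 -> dvdmx (c * d) (c *: A) -> dvdmx d A.
Proof.
move=> c0 [B]; rewrite -scalerA => eAB; exists B.
by apply/matrixP=> i j; move/matrixP/(_ i j): eAB; rewrite !mxE; apply: mulfI.
Qed.

Lemma dvdmx_mull d m n q (A : 'M_(m, n)) (B : 'M_(n, q)) :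
  dvdmx d B -> dvdmx d (A *m B).
Proof. by move=> [B' ->]; exists (A *m B'); rewrite scalemxAr. Qed.

Lemma dvdmx_mulr d m n q (A : 'M_(m, n)) (B : 'M_(n, q)) :
  dvdmx d A -> dvdmx d (A *m B).
Proof. by move=> [A' ->]; exists (A' *m B); rewrite scalemxAl. Qed.

Lemma dvdmx_trans c d m n (A : 'M_(m, n)) : dvdmx (c * d) A -> dvdmx c A.
Proof. by move=> [B ->]; rewrite -scalerA; apply: dvdmx_scalel. Qed.

Lemma dvdmx_exp1 d k m n (A : 'M_(m, n)) :
  (0 < k)%N -> dvdmx (d ^+ k) A -> dvdmx d A.
Proof. by case: k => // k _; rewrite exprS; apply: dvdmx_trans. Qed.

Lemma intr_Zp_eq0 q (z : int) : (1 < q)%N ->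
  ((z%:~R : 'Z_q) == 0) = (q%:Z %| z)%Z.
Proof.
move=> q1; have natZ n : ((n%:R : 'Z_q) == 0) = (q %| n)%N.
  by rewrite -val_eqE /= val_Zp_nat.
case: z => n; first exact: natZ.
by rewrite NegzE rmorphN oppr_eq0 [LHS]natZ dvdzE abszN.
Qed.

Lemma map_intr_eq0 q m n (A : 'M[int]_(m, n)) : (1 < q)%N ->
  (map_mx intr A = 0 :> 'M['Z_q]_(m, n)) <-> dvdmx q A.
Proof.
move=> q1; split=> [/matrixP A0|[B ->]].
  exists (\matrix_(i, j) (A i j %/ q)%Z); apply/matrixP=> i j; rewrite !mxE.
  by rewrite mulrC divzK // -intr_Zp_eq0 //; move: (A0 i j); rewrite !mxE => ->.
apply/matrixP=> i j; rewrite !mxE; apply/eqP.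
by rewrite intr_Zp_eq0 // dvdz_mulr.
Qed.

(** * Unipotent matrices modulo p *)

Lemma det_mx22 (R : comNzRingType) (A : 'M[R]_2) :
  \det A = A 0 0 * A 1 1 - A 0 1 * A 1 0.
Proof.
rewrite (expand_det_row _ 0) !big_ord_recl big_ord0 /cofactor !det_mx11 !mxE.
have -> : lift 0 0 = 1 :> 'I_2 by apply/val_inj.
have -> : lift 1 0 = 0 :> 'I_2 by apply/val_inj.
by rewrite /= expr0 expr1; ring.
Qed.

Lemma det1_unipotent (F : fieldType) (p j : nat) (M : 'M[F]_2) (v : 'cV_2) :
  p \in [pchar F] -> \det M = 1 -> v != 0 -> (M ^+ (p ^ j) - 1) *m v = 0 ->
  M ^+ p = 1.
Proof.
move=> pF detM v0 Mv.
have pM : p \in [pchar 'M[F]_2].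
  rewrite inE (pcharf_prime pF) /= -scaler_nat.
  by rewrite (pcharf0 pF) scale0r eqxx.
have frob i : (M - 1) ^+ (p ^ i) = M ^+ (p ^ i) - 1.
  elim: i => [|i IH]; first by rewrite !expr1.
  rewrite expnSr !exprM IH -!(pFrobenius_autE pM).
  by rewrite pFrobenius_autB_comm ?pFrobenius_aut1 //; apply: commr1.
(* M - 1 is singular: its p^j-th power M^(p^j) - 1 kills v. *)
have det0 : \det (M - 1) = 0.
  apply/eqP; rewrite -[_ == 0]negbK -unitfE -[_ \is a _]/(M - 1 \in unitmx).
  apply: contra v0 => uM; rewrite -[v]mul1mx.
  have uMj : (M - 1) ^+ (p ^ j) \in unitmx by apply: unitrX.
  by rewrite -(mulVmx uMj) -mulmxA frob Mv mulmx0.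
(* det M = 1 and det (M - 1) = 0 give tr M = 2; now use Cayley-Hamilton. *)
have M2 : (M - 1) ^+ 2 = 0.
  have ord2 (i : 'I_2) : i = 0 \/ i = 1.
    by case: i => [[|[|[]]]] // ?; [left | right]; apply/val_inj.
  have lift1 : lift ord0 ord0 = 1 :> 'I_2 by apply/val_inj.
  move: detM det0; rewrite !det_mx22 !mxE /= => e1 e0.
  have e : M 1 1 = 2 - M 0 0.
    apply/eqP; rewrite -subr_eq0; apply/eqP.
    transitivity ((M 0 0 * M 1 1 - M 0 1 * M 1 0) - 1 - 0).
      by rewrite -e0; ring.
    by rewrite e1; ring.
  have e' : M 0 1 * M 1 0 = (2 - M 0 0) * M 0 0 - 1 by rewrite -e -e1; ring.
  apply/matrixP=> i l; rewrite expr2 mxE !big_ord_recl big_ord0 !mxE lift1.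
  by case: (ord2 i) => ->; case: (ord2 l) => -> /=; rewrite ?e; ring: e'.
have p2 := prime_gt1 (pcharf_prime pF).
(* By Frobenius, M^p - 1 = (M - 1)^p, which has the factor (M - 1)^2 because p is at least 2. *)
apply/eqP; rewrite -subr_eq0 -[p]expn1 -frob expn1 -(subnKC p2) exprD M2 mul0r.
exact: eqxx.
Qed.

Lemma unipotent_mod_p p j (D : 'M[int]_2) (v : 'cV_2) :
  prime p -> \det D = 1 -> ~ dvdmx p v ->
  dvdmx p ((D ^+ (p ^ j) - 1) *m v) -> dvdmx p (D ^+ p - 1).
Proof.
move=> pp detD pv.
have mod_p m n (A : 'M_(m, n)) :
    dvdmx p A <-> map_mx intr A = 0 :> 'M['F_p]_(m, n).
  (* ['F_p] unfolds to ['Z_(pdiv p)]. *)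
  by rewrite map_intr_eq0 ?pdiv_id ?prime_gt1.
move/mod_p; rewrite map_mxM rmorphB rmorphXn rmorph1 => Dv.
apply/mod_p; rewrite rmorphB rmorphXn rmorph1 /=.
apply/eqP; rewrite subr_eq0; apply/eqP.
apply: (@det1_unipotent 'F_p _ j _ (map_mx intr v)) => //.
- exact: pchar_Fp.
- by rewrite det_map_mx detD rmorph1.
- by apply/eqP=> v0; apply/pv/mod_p.
Qed.

(** * The p-adic valuation of E^p - 1 *)

Lemma subrX1r (R : pzRingType) (x : R) n :
  x ^+ n - 1 = (\sum_(i < n) x ^+ i) * (x - 1).
Proof.
rewrite subrX1; apply: commr_sum => i _; apply: commrX; apply: commr_sym.
by apply: commrB; [apply: commr_refl | apply: commr1].
Qed.

Lemma sum_pow_mod d (E : 'M[int]_2) n :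
  dvdmx d (E - 1) -> dvdmx d (\sum_(i < n) E ^+ i - n%:R).
Proof.
move=> dE; elim: n => [|n IH]; first by rewrite big_ord0 subrr; apply: dvdmx0.
rewrite big_ord_recr mulrSr /= opprD addrACA; apply: dvdmxD => //.
by rewrite subrX1; apply: dvdmx_mulr.
Qed.

(** In E^p - 1 = (E - 1)(1 + E + ... + E^(p-1)) both factors vanish modulo p, the second because it
    is congruent to p. *)
Lemma pow_p_mod_p2 (p : nat) (E : 'M[int]_2) :
  dvdmx p (E - 1) -> dvdmx (p%:Z ^+ 2) (E ^+ p - 1).
Proof.
move=> pE; rewrite subrX1; case: (pE) => B ->; rewrite -scalerAl expr2.
apply: dvdmx_scale; apply: dvdmx_mull.
rewrite -[\sum_(_ < _) _](subrK p%:R); apply: dvdmxD; first exact: sum_pow_mod.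
by exists 1; rewrite -natz scaler_nat.
Qed.

(** Instead of inverting 1 + dY, bootstrap: if d^i divides w, then d^(i+1) divides dYw, hence also
    w. *)
Lemma dvdmx_one_plus d k (Y : 'M[int]_2) (w : 'cV_2) :
  dvdmx (d ^+ k) (w + d *: (Y *m w)) -> dvdmx (d ^+ k) w.
Proof.
move=> dw; suff H i : (i <= k)%N -> dvdmx (d ^+ i) w by apply: H.
elim: i => [_|i IH ik]; first by exists w; rewrite scale1r.
have dw' : dvdmx (d ^+ i.+1) (w + d *: (Y *m w)).
  by apply: (@dvdmx_trans _ (d ^+ (k - i.+1))); rewrite -exprD subnKC.
rewrite -[w](addrK (d *: (Y *m w))); apply: dvdmxD => //; apply: dvdmxN.
by rewrite exprS; apply/dvdmx_scale/dvdmx_mull/IH/ltnW.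
Qed.

(** Congruence to 1 modulo p alone would not do: for p = 2 and E = -1, E^p - 1 is zero. *)
Lemma valuation_step (p k : nat) (E : 'M[int]_2) (v : 'cV_2) :
  p != 0%N -> dvdmx (p%:Z ^+ 2) (E - 1) ->
  dvdmx (p%:Z ^+ k) ((E - 1) *m v) <-> dvdmx (p%:Z ^+ k.+1) ((E ^+ p - 1) *m v).
Proof.
move=> p0 E1; have [Y eY] := sum_pow_mod p E1.
(* 1 + E + ... + E^(p-1) = p + p^2 Y, so E^p - 1 = p (1 + p Y) (E - 1), and
   1 + p Y is invertible modulo every power of p. *)
have -> : (E ^+ p - 1) *m v =
    p%:Z *: ((E - 1) *m v + p%:Z *: (Y *m ((E - 1) *m v))).
  rewrite subrX1r -[\sum_(_ < _) _](subrK p%:R) eY mulrDl.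
  rewrite mulr_natl -scaler_nat natz -mulmxE -scalemxAl mulmxDl -!scalemxAl.
  by rewrite scalerDr scalerA mulmxA addrC expr2.
rewrite exprS; split=> [kE|]; last first.
  by move/(dvdmx_cancel _)=> H; apply/dvdmx_one_plus/H.
apply/dvdmx_scale/dvdmxD => //; case: (kE) => B ->.
by exists (p%:Z *: (Y *m B)); rewrite -scalemxAr !scalerA mulrC.
Qed.

(** * Fixed vectors modulo powers of p *)

Lemma det1X (R : comNzRingType) n (A : 'M[R]_n.+1) m :
  \det A = 1 -> \det (A ^+ m) = 1.
Proof.
by move=> A1; elim: m => [|m IH]; rewrite ?det1 // exprS det_mulmx A1 IH mulr1.
Qed.

(** Since k > 0, either side makes C^(pn) fix v modulo p, and this already forces the congruence
    modulo p^2 that [valuation_step] requires. *)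
Lemma primitive_step (p k n : nat) (C : 'M[int]_2) (v : 'cV_2) :
  prime p -> \det C = 1 -> (0 < k)%N -> (p ^ 2 %| n)%N -> ~ dvdmx p v ->
  dvdmx (p%:Z ^+ k) ((C ^+ n - 1) *m v) <->
  dvdmx (p%:Z ^+ k.+1) ((C ^+ (p * n) - 1) *m v).
Proof.
move=> pp detC k0 /dvdnP[m ->] pv; set n' := (m * p ^ 2)%N.
have unip : dvdmx p ((C ^+ (p * n') - 1) *m v) ->
     dvdmx (p%:Z ^+ 2) (C ^+ n' - 1).
  (* With D = C^m, the vector v is fixed by D^(p^3) modulo p, so D^p is 1 modulo p and C^n = (D^p)^p
     is 1 modulo p^2. *)
  move=> Cv; rewrite /n' expnS expn1 mulnA exprM; apply: pow_p_mod_p2.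
  rewrite exprM; apply: (@unipotent_mod_p _ 3 _ v) => //.
    exact: det1X.
  by rewrite -exprM expnS mulnCA.
have p0 : p != 0%N by rewrite -lt0n prime_gt0.
have Cpn : C ^+ (p * n') = (C ^+ n') ^+ p by rewrite mulnC exprM.
have step Cv := valuation_step k v p0 (unip Cv).
split=> Cv; [rewrite Cpn|]; apply/step; rewrite -?Cpn //.
  rewrite Cpn subrX1r -mulmxE -mulmxA; apply: dvdmx_mull.
  exact: dvdmx_exp1 Cv.
exact: dvdmx_exp1 Cv.
Qed.

Lemma dvdmx_dec q m n (A : 'M[int]_(m, n)) :
  (1 < q)%N -> dvdmx q A \/ ~ dvdmx q A.
Proof.
move=> q1; rewrite -map_intr_eq0 //.
by case: (map_mx intr A =P 0 :> 'M['Z_q]_(m, n)); [left | right].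
Qed.

(** Factors p of v are divided out one at a time, each lowering both exponents by one, until
    [primitive_step] applies; the exponent cannot reach 0, as 1 divides everything. *)
Lemma fixed_step (p k n : nat) (C : 'M[int]_2) (v : 'cV_2) :
  prime p -> \det C = 1 -> (p ^ 2 %| n)%N -> ~ dvdmx (p%:Z ^+ k) v ->
  dvdmx (p%:Z ^+ k) ((C ^+ n - 1) *m v) <->
  dvdmx (p%:Z ^+ k.+1) ((C ^+ (p * n) - 1) *m v).
Proof.
move=> pp detC pn; have p0 : p%:Z != 0 by rewrite -lt0n prime_gt0.
elim: k v => [|k IH] v pv; first by case: pv; exists v; rewrite scale1r.
have [[w ev]|pv1] := dvdmx_dec v (prime_gt1 pp); last exact: primitive_step.
have {}pv : ~ dvdmx (p%:Z ^+ k) w.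
  by move=> kw; apply: pv; rewrite ev exprS; apply: dvdmx_scale.
rewrite ev -!scalemxAr.
have [IH1 IH2] := IH w pv.
by split; rewrite exprS => /(dvdmx_cancel p0) H; rewrite exprS;
  apply: dvdmx_scale; [apply: IH1 | apply: IH2].
Qed.

(** This covers the vectors v = p^k w excluded from [fixed_step]: only w modulo p matters, and
    unless p divides w, C^n is 1 modulo p. *)
Lemma fixed_descent (p k n : nat) (C : 'M[int]_2) (v : 'cV_2) :
  prime p -> \det C = 1 -> (p %| n)%N -> dvdmx (p%:Z ^+ k) v ->
  dvdmx (p%:Z ^+ k.+1) ((C ^+ (p * n) - 1) *m v) ->
  dvdmx (p%:Z ^+ k.+1) ((C ^+ n - 1) *m v).
Proof.
move=> pp detC /dvdnP[m ->] [w ->]; rewrite -!scalemxAr exprSr.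
have pk0 : p%:Z ^+ k != 0 by rewrite expf_neq0 // -lt0n prime_gt0.
move/(dvdmx_cancel pk0) => Cw; apply: dvdmx_scale.
have [pw|pw] := dvdmx_dec w (prime_gt1 pp); first exact: dvdmx_mull.
apply: dvdmx_mulr; rewrite exprM; apply: (@unipotent_mod_p _ 2 _ w) => //.
  exact: det1X.
by rewrite -exprM expnS expn1 mulnCA.
Qed.

(** * Orbit lengths through divisibility *)

Lemma iter_fixed_order (T : finType) (f : T -> T) x n :
  injective f -> (iter n f x == x) = (order f x %| n)%N.
Proof.
move=> fI; apply/eqP/idP => [fx|/dvdnP[m ->]]; last first.
  by elim: m => // m IH; rewrite mulSn iterD IH iter_order.
have fo m : iter (m * order f x) f x = x.
  by elim: m => // m IH; rewrite mulSn iterD IH iter_order.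
have lt_mod : (n %% order f x < order f x)%N by rewrite ltn_mod order_gt0.
move: fx; rewrite (divn_eq n (order f x)) addnC iterD fo => fx.
rewrite dvdn_addl ?dvdn_mull //.
by rewrite -[X in (_ %| X)%N](findex_iter lt_mod) fx findex0.
Qed.

(** Turns an exact order into conditions that certain iterates fix a point or not. Conversely, if n
    = cm with c > 1, a prime q dividing c gives m | n/q. *)
Lemma eq_dvdn_prime m n : (0 < n)%N ->
  (m = n) <->
  ((m %| n)%N /\ forall q, prime q -> (q %| n)%N -> ~~ (m %| n %/ q)%N).
Proof.
move=> n0; split=> [->|[/dvdnP[c en] H]].
  split=> // q pq qn; apply/negP=> /dvdn_leq.
  rewrite divn_gt0 ?prime_gt0 // dvdn_leq // => /(_ isT).
  by rewrite leqNgt ltn_Pdiv ?prime_gt1.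
have [c1|c1] := ltnP 1 c; last first.
  by move: n0 c1; rewrite en; case: c {en} => [|[|]] //; rewrite mul1n.
have qc := pdiv_dvd c; have pq := pdiv_prime c1.
have := H _ pq; rewrite en dvdn_mulr // => /(_ isT).
by rewrite -divn_mulAC // dvdn_mull.
Qed.

(** * Periods of the Cat map *)

Lemma iter_cat_map (p : nat) a b k n (w : 'cV[int]_2) :
  iter n (@cat_map p a b k) (map_mx intr w) =
  map_mx intr (cat_matrix a b ^+ n *m w).
Proof.
elim: n => [|n IH]; first by rewrite expr0 mul1mx.
by rewrite iterS IH /cat_map -map_mxM exprS -mulmxE mulmxA.
Qed.

Lemma iter_cat_map_fixed (p : nat) a b k n (w : 'cV[int]_2) : (1 < p ^ k)%N ->
  iter n (@cat_map p a b k) (map_mx intr w) == map_mx intr w <->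
  dvdmx (p%:Z ^+ k) ((cat_matrix a b ^+ n - 1) *m w).
Proof.
move=> q1; rewrite iter_cat_map -subr_eq0 -map_mxB mulmxBl mul1mx.
rewrite -[p%:Z]natz -natrX natz -map_intr_eq0 //; split=> [/eqP|->] //.
Qed.

Lemma det_cat_matrix a b : \det (cat_matrix a b) = 1.
Proof. by rewrite det_mx22 !mxE /=; ring. Qed.

Lemma cat_map_inj (p : nat) a b k : injective (@cat_map p a b k).
Proof.
have uC : (map_mx intr (cat_matrix a b) : 'M['Z_(p ^ k)]_2) \in unitmx.
  by rewrite unitmxE det_map_mx det_cat_matrix rmorph1 unitr1.
exact: (can_inj (mulKmx uC)).
Qed.

Lemma order_cat_map_step (p : nat) a b k T (w : 'cV[int]_2) :
  prime p -> (0 < k)%N -> (0 < T)%N -> (p ^ 3 %| T)%N ->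
  order (@cat_map p a b k) (map_mx intr w) = T <->
  order (@cat_map p a b k.+1) (map_mx intr w) = (p * T)%N.
Proof.
move=> pp k0 T0 pT; have p0 := prime_gt0 pp.
have q1 j : (0 < j)%N -> (1 < p ^ j)%N.
  by move=> ?; rewrite -{1}(exp1n j) ltn_exp2r // prime_gt1.
have fixE j n : (0 < j)%N ->
    (order (@cat_map p a b j) (map_mx intr w) %| n)%N <->
    dvdmx (p%:Z ^+ j) ((cat_matrix a b ^+ n - 1) *m w).
  move=> j0; rewrite -iter_fixed_order ?iter_cat_map_fixed ?q1 //.
  exact: cat_map_inj.
have p_T : (p %| T)%N by apply: dvdn_trans pT; rewrite dvdn_exp.
rewrite !eq_dvdn_prime ?muln_gt0 ?p0 //.
have detC := det_cat_matrix a b.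
have pk1 : (1 < p ^ k)%N by apply: q1.
have [pw|pw] := dvdmx_dec w pk1.
  (* Here w is 0 modulo p^k, and the criterion fails at the prime p on both sides: the order modulo
     p^k divides T/p, and by [fixed_descent] the one modulo p^(k+1) would divide T = pT/p. *)
  have {}pw : dvdmx (p%:Z ^+ k) w by rewrite -[p%:Z]natz -natrX natz.
  split=> [] [fT /(_ p pp)].
    rewrite p_T => /(_ isT) /negP[]; apply/fixE => //; exact: dvdmx_mull.
  rewrite dvdn_mulr // => /(_ isT) /negP[]; rewrite mulKn //.
  by apply/fixE => //; apply: fixed_descent => //; apply/fixE.
have {}pw : ~ dvdmx (p%:Z ^+ k) w by rewrite -[p%:Z]natz -natrX natz.
have step n : (p ^ 2 %| n)%N ->
    (order (@cat_map p a b k) (map_mx intr w) %| n)%N =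
    (order (@cat_map p a b k.+1) (map_mx intr w) %| p * n)%N.
  by move=> pn; apply/idP/idP=> /fixE H; apply/fixE=> //;
    apply/(fixed_step pp detC pn pw)/H.
have p2T : (p ^ 2 %| T)%N by apply: dvdn_trans pT; rewrite dvdn_exp2l.
rewrite -step //.
(* Dividing by q removes at most one factor p from T, so p^3 | T leaves the p^2 needed by [step]. *)
have p2Tq q : prime q -> (q %| T)%N -> (p ^ 2 %| T %/ q)%N.
  move=> pq qT; rewrite dvdn_divRL //; have [->|qp] := eqVneq q p.
    by rewrite -expnSr.
  rewrite Gauss_dvd ?p2T // coprimeXl // prime_coprime // dvdn_prime2 //.
  by rewrite eq_sym.
split=> -[fT H]; split=> // q pq qT; last first.
  by rewrite step ?p2Tq // muln_divA // H // dvdn_mull.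
(* As p | T, the primes dividing pT are those dividing T. *)
have {}qT : (q %| T)%N.
  move: qT; rewrite Euclid_dvdM // => /orP[|//].
  by rewrite dvdn_prime2 // => /eqP->.
by rewrite -muln_divA // -step ?p2Tq ?H.
Qed.

(** * Counting points over a reduction map *)

Definition lift_Zp q m n (A : 'M['Z_q]_(m, n)) : 'M[int]_(m, n) :=
  map_mx (fun x : 'Z_q => (x : nat)%:Z) A.

Lemma lift_ZpK q m n : cancel (@lift_Zp q m n) (map_mx intr).
Proof. by move=> A; apply/matrixP=> i j; rewrite !mxE; apply: natr_Zp. Qed.

(** Writing each coordinate as cq + u with c < d and u < q, reduction modulo q keeps u and forgets
    c, so each fibre has d^n points. *)
Lemma card_reduction d q r n (S : {set 'cV['Z_q]_n}) :
  (1 < q)%N -> (0 < d)%N -> r = (d * q)%N ->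
  #|[set y : 'cV['Z_r]_n | map_mx intr (lift_Zp y) \in S]| = (d ^ n * #|S|)%N.
Proof.
move=> q1 d0 ->; have dq1 : (1 < d * q)%N.
  by apply: leq_trans q1 _; rewrite leq_pmull.
have ltq (x : 'Z_q) : (x < q)%N by rewrite -[X in (_ < X)%N](Zp_cast q1).
pose phi (u : 'cV['Z_q]_n * 'cV['I_d]_n) : 'cV['Z_(d * q)]_n :=
  \col_i (u.2 i ord0 * q + u.1 i ord0)%:R.
have phiE u i : phi u i ord0 = (u.2 i ord0 * q + u.1 i ord0)%N :> nat.
  rewrite mxE val_Zp_nat // modn_small //.
  apply: (@leq_trans ((u.2 i ord0).+1 * q)).
    by rewrite mulSn addnC ltn_add2r.
  by rewrite leq_mul2r ltn_ord orbT.
have phi_inj : injective phi.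
  move=> [x c] [x' c'] /matrixP e; congr (_, _); apply/matrixP=> i j;
    have := congr1 val (e i ord0); rewrite (ord1 j) /= !phiE /= => {}e;
    apply: val_inj => /=.
    by move: (congr1 (modn^~ q) e); rewrite !modnMDl !modn_small.
  move: (congr1 (divn^~ q) e).
  by rewrite !divnMDl ?(ltnW q1) // !divn_small // !addn0.
have phi_bij : bijective phi.
  apply: inj_card_bij => //; rewrite card_prod !card_mx !card_ord !Zp_cast //.
  by rewrite muln1 -expnMn mulnC.
have red_phi u : map_mx intr (lift_Zp (phi u)) = u.1.
  apply/matrixP=> i j; rewrite ord1 2!mxE phiE.
  apply: val_inj.
  rewrite -[LHS]/(val ((u.2 i ord0 * q + u.1 i ord0)%:R : 'Z_q)) /=.
  by rewrite val_Zp_nat // modnMDl modn_small.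
rewrite -(on_card_preimset (onW_bij _ phi_bij)).
have -> : phi @^-1: [set y | map_mx intr (lift_Zp y) \in S] = setX S setT.
  by apply/setP=> u; rewrite !inE red_phi andbT.
by rewrite cardsX cardsT card_mx card_ord muln1 mulnC.
Qed.

Lemma num_cycles_card (p : nat) a b T k :
  (num_cycles p a b T k * T)%N = #|[set v | order (@cat_map p a b k) v == T]|.
Proof.
rewrite cardsE; apply: fcard_order_set => //; first exact: cat_map_inj.
(* Invariance of the order set: on a cycle, a point and its image have the same order. *)
move=> v w /eqP <-; rewrite !inE; congr (_ == _); apply/esym.
by apply/(orbitPcycle 4 1); apply/iter_order/cat_map_inj.
Qed.

Theorem theorem5 (p : nat) (hp : prime p) (a b : int)
    (Tc : nat) (hTc : (0 < Tc)%N) (hnu : (p < logn p Tc)%N)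
    (k : nat) (hk : (0 < k)%N) :
  (p * num_cycles p a b Tc k)%N = num_cycles p a b (p * Tc) k.+1.
Proof.
have p0 := prime_gt0 hp.
have p3T : (p ^ 3 %| Tc)%N.
  (* The valuation exceeds p, which is at least 2. *)
  by rewrite pfactor_dvdn // (leq_trans _ hnu) // ltnS prime_gt1.
have pk1 : (1 < p ^ k)%N by rewrite -{1}(exp1n k) ltn_exp2r // prime_gt1.
(* Multiplying by the cycle length pT turns cycles into points; the left side becomes p^2 times the
   number of points of order T. *)
apply/eqP; rewrite -(eqn_pmul2r (_ : 0 < p * Tc)%N) ?muln_gt0 ?p0 //.
rewrite num_cycles_card mulnACA num_cycles_card mulnn.
rewrite -(card_reduction _ pk1 p0 (expnS p k)); apply/eqP.
apply: eq_card => y; rewrite !inE.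
have step := order_cat_map_step a b (lift_Zp y) hp hk hTc p3T.
by apply/eqP/eqP=> [/step|e]; [|apply/step]; rewrite (@lift_ZpK (p ^ k.+1)).
Qed.
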